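(* Let $M$ be a countably infinite $\aleph_0$-categorical structure with domain $\omega$. Then $V=\mathrm{Aut}(\mathcal E_M)/\mathrm{Aut}(M)$ is a profinite group. If $M$ is interdefinable with a structure in a finite signature, then $V$ is finite.
   Context: ''Definable'' means $\emptyset$-definable. Orbital structure: for an $\aleph_0$-categorical structure $M$ with domain $\omega$, $\mathcal E_M$ is the structure with domain $\omega$ in the language $\{\sim_n: 0<n<\omega\}$, where $\sim_n$ is a $2n$-ary relation symbol, and $\bar a\sim_n\bar b$ holds (for $\bar a,\bar b\in\omega^n$) iff there is $g\in\mathrm{Aut}(M)$ with $g(\bar a)=\bar b$. ($\mathrm{Aut}(\mathcal E_M)$ is the normaliser of $\mathrm{Aut}(M)$ in $\mathrm{Sym}(\omega)$, so $\mathrm{Aut}(M)$ is normal in it.) Automorphism groups carry the topology of pointwise convergence as closed subgroups of $\mathrm{Sym}(\omega)$, and $V$ carries the quotient topology. Two structures on the same domain are interdefinable if they have the same definable relations.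
   Formalization: The language of M is assumed countable (the usual convention for ℵ0-categoricity); without this the claim fails, e.g. when every relation on ω is named, so that Aut(M) is trivial and V = Sym(ω) is not compact. *)

(* Defs.v *)
From HB Require Import structures.
From mathcomp Require Import all_boot.
From mathcomp Require Import boolp classical_sets functions cardinality.
From mathcomp Require Import topology.

Set Implicit Arguments.
Unset Strict Implicit.
Unset Printing Implicit Defensive.

Local Open Scope classical_set_scope.
Local Open Scope group_scope.
Local Open Scope quotient_scope.

(** Constants are function symbols of arity [0]. *)
Record signature : Type := Signature {
  fun_sym : Type;
  fun_ar : fun_sym -> nat;
  rel_sym : Type;
  rel_ar : rel_sym -> nat }.

(** [aleph0_categorical] is meant for countable signatures: if all relations
    and functions on [nat] are named, [nat] is, up to isomorphism, the only
    countable model of its theory, although its automorphism group is trivial. *)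
Definition countable_signature (L : signature) : Prop :=
  countable [set: fun_sym L] /\ countable [set: rel_sym L].

Definition finite_signature (L : signature) : Prop :=
  finite_set [set: fun_sym L] /\ finite_set [set: rel_sym L].

Record structure (L : signature) (D : Type) : Type := Structure {
  fun_int : forall f : fun_sym L, ('I_(fun_ar f) -> D) -> D;
  rel_int : forall r : rel_sym L, ('I_(rel_ar r) -> D) -> Prop }.

(** [term L n] and [formula L n] have their free variables among
    [x_0, ..., x_(n-1)]; [Forall] binds [x_0] and shifts the other variables. *)
Inductive term (L : signature) (n : nat) : Type :=
| Var of 'I_n
| App (f : fun_sym L) of ('I_(fun_ar f) -> term L n).

Inductive formula (L : signature) : nat -> Type :=
| Falsum n : formula L n
| Equal n of term L n & term L n : formula L n
| Rel n (r : rel_sym L) of ('I_(rel_ar r) -> term L n) : formula L n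
| Imp n of formula L n & formula L n : formula L n
| Forall n of formula L n.+1 : formula L n.

Definition sentence (L : signature) : Type := formula L 0.

Definition extend (D : Type) (n : nat) (d : D) (a : 'I_n -> D) :
    'I_n.+1 -> D :=
  fun i => if unlift ord0 i is Some j then a j else d.

Fixpoint eval (L : signature) (D : Type) (M : structure L D) (n : nat)
    (a : 'I_n -> D) (t : term L n) : D :=
  match t with
  | Var i => a i
  | App f ts => fun_int M (fun i => eval M a (ts i))
  end.

Fixpoint sat (L : signature) (D : Type) (M : structure L D) (n : nat)
    (phi : formula L n) : ('I_n -> D) -> Prop :=
  match phi in formula _ n return ('I_n -> D) -> Prop with
  | Falsum _ => fun _ => False
  | Equal _ t u => fun a => eval M a t = eval M a u
  | Rel _ r ts => fun a => rel_int M (fun i => eval M a (ts i))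
  | Imp _ psi chi => fun a => sat M psi a -> sat M chi a
  | Forall _ psi => fun a => forall d : D, sat M psi (extend d a)
  end.

(** There is exactly one assignment ['I_0 -> D]. *)
Definition holds (L : signature) (D : Type) (M : structure L D)
    (phi : sentence L) : Prop :=
  forall a : 'I_0 -> D, sat M phi a.

Definition models (L : signature) (D : Type) (M : structure L D)
    (T : set (sentence L)) : Prop :=
  forall phi, T phi -> holds M phi.

Definition Th (L : signature) (D : Type) (M : structure L D) :
    set (sentence L) :=
  [set phi | holds M phi].

Definition isomorphism (L : signature) (D D' : Type) (M : structure L D)
    (N : structure L D') (h : D -> D') : Prop :=
  [/\ bijective h,
      forall (f : fun_sym L) (a : 'I_(fun_ar f) -> D),
        h (fun_int M a) = fun_int N (h \o a) &
      forall (r : rel_sym L) (a : 'I_(rel_ar r) -> D),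
        rel_int M a <-> rel_int N (h \o a)].

Definition isomorphic (L : signature) (D D' : Type) (M : structure L D)
    (N : structure L D') : Prop :=
  exists h : D -> D', isomorphism M N h.

Definition countably_infinite (D : Type) : Prop :=
  ([set: D] #= [set: nat])%card.

Definition aleph0_categorical_theory (L : signature) (T : set (sentence L)) :
    Prop :=
  (exists (D : Type) (M : structure L D), countably_infinite D /\ models M T)
  /\ forall (D D' : Type) (M : structure L D) (N : structure L D'),
       countably_infinite D -> countably_infinite D' ->
       models M T -> models N T -> isomorphic M N.

Definition aleph0_categorical (L : signature) (D : Type) (M : structure L D) :
    Prop :=
  aleph0_categorical_theory (Th M).

Definition definable (L : signature) (D : Type) (M : structure L D) (n : nat)
    (R : set ('I_n -> D)) : Prop :=
  exists phi : formula L n, forall a, R a <-> sat M phi a.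

Definition interdefinable (L L' : signature) (D : Type) (M : structure L D)
    (N : structure L' D) : Prop :=
  forall (n : nat) (R : set ('I_n -> D)), definable M R <-> definable N R.

#[short(type="preTopologicalGroupType")]
HB.structure Definition PreTopologicalGroup := {G of Group G & Topological G}.

Definition topological_group (G : preTopologicalGroupType) : Prop :=
  continuous (fun xy : G * G => xy.1 * xy.2) /\
  continuous (fun x : G => x^-1).

Definition profinite (G : preTopologicalGroupType) : Prop :=
  [/\ topological_group G, compact [set: G], hausdorff_space G &
      totally_disconnected [set: G]].

Record normal_subgroup (G : groupType) : Type := NormalSubgroup {
  nsub :> set G;
  nsub1 : nsub 1;
  nsubM : forall x y : G, nsub x -> nsub y -> nsub (x * y);
  nsubV : forall x : G, nsub x -> nsub x^-1;
  nsubJ : forall x y : G, nsub x -> nsub (x ^ y) }.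

Section QuotientGroup.
Variables (G : preTopologicalGroupType) (N : normal_subgroup G).

Definition coset_rel : rel G := fun x y => `[< nsub N (x^-1 * y) >].

Lemma coset_rel_refl : reflexive coset_rel.
Proof. by move=> x; apply/asboolP; rewrite mulVg; exact: nsub1. Qed.

Lemma coset_rel_sym : symmetric coset_rel.
Proof.
move=> x y; apply/asboolP/asboolP => /nsubV; by rewrite invgM invgK.
Qed.

Lemma coset_rel_trans : transitive coset_rel.
Proof.
move=> y x z /asboolP xy /asboolP yz; apply/asboolP.
by have := nsubM xy yz; rewrite mulgA mulgK.
Qed.

Canonical coset_equiv :=
  EquivRel coset_rel coset_rel_refl coset_rel_sym coset_rel_trans.

Definition quotient_group : Type := quotient_topology {eq_quot coset_equiv}.

HB.instance Definition _ := Topological.copy quotient_group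
  (quotient_topology {eq_quot coset_equiv}).
HB.instance Definition _ := Quotient.copy quotient_group
  (quotient_topology {eq_quot coset_equiv}).

Definition to_coset (x : G) : quotient_group := \pi_quotient_group x.

Lemma coset_eqP (x y : G) : reflect (to_coset x = to_coset y) (coset_rel x y).
Proof. by apply: (iffP (@eqmodP G coset_equiv x y)) => h; exact: h. Qed.

Lemma coset_repr (u : quotient_group) : to_coset (repr u) = u.
Proof. exact: reprK. Qed.

Lemma coset_ind (P : quotient_group -> Prop) :
  (forall x : G, P (to_coset x)) -> forall u, P u.
Proof. by move=> Pcoset u; rewrite -[u]coset_repr. Qed.

Definition quotient_one : quotient_group := to_coset 1.
Definition quotient_mul (u v : quotient_group) : quotient_group :=
  to_coset (repr u * repr v).
Definition quotient_inv (u : quotient_group) : quotient_group :=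
  to_coset (repr u)^-1.

Lemma repr_to_coset (x : G) : nsub N ((repr (to_coset x))^-1 * x).
Proof. by apply/asboolP/coset_eqP; rewrite coset_repr. Qed.

Lemma cosetM (x y : G) : quotient_mul (to_coset x) (to_coset y) = to_coset (x * y).
Proof.
apply/coset_eqP/asboolP.
have := nsubM (nsubJ (repr (to_coset y)) (repr_to_coset x)) (repr_to_coset y).
by rewrite conjgE invgM !mulgA mulgK.
Qed.

Lemma cosetV (x : G) : quotient_inv (to_coset x) = to_coset x^-1.
Proof.
apply/coset_eqP/asboolP.
have := nsubJ x^-1 (nsubV (repr_to_coset x)).
by rewrite conjgE invgM !invgK !mulgA mulgV mul1g.
Qed.

Lemma quotient_mulA : associative quotient_mul.
Proof.
apply: coset_ind => x; apply: coset_ind => y; apply: coset_ind => z.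
by rewrite !cosetM mulgA.
Qed.

Lemma quotient_mul1 : left_id quotient_one quotient_mul.
Proof. by apply: coset_ind => x; rewrite cosetM mul1g. Qed.

Lemma quotient_mulr1 : right_id quotient_one quotient_mul.
Proof. by apply: coset_ind => x; rewrite cosetM mulg1. Qed.

Lemma quotient_mulV : left_inverse quotient_one quotient_inv quotient_mul.
Proof. by apply: coset_ind => x; rewrite cosetV cosetM mulVg. Qed.

Lemma quotient_mulrV : right_inverse quotient_one quotient_inv quotient_mul.
Proof. by apply: coset_ind => x; rewrite cosetV cosetM mulgV. Qed.

HB.instance Definition _ := isGroup.Build quotient_group
  quotient_mulA quotient_mul1 quotient_mulr1 quotient_mulV quotient_mulrV.

End QuotientGroup.

(** Topologized as a subspace of [nat -> nat] with the topology of pointwise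
    convergence, [nat] being discrete. *)
Definition Sym : Type := [set g : {ptws nat -> nat} | bijective g].

HB.instance Definition _ := Topological.on Sym.
HB.instance Definition _ := SubChoice.on Sym.

Definition sym_fun (g : Sym) : nat -> nat := \val g.
Coercion sym_fun : Sym >-> Funclass.

Lemma sym_bij (g : Sym) : bijective g.
Proof. exact: (set_valP g). Qed.

Lemma sym_eqP (g h : Sym) : g =1 h -> g = h.
Proof. by move=> gh; apply/val_inj/funext. Qed.

Definition mk_sym (g : nat -> nat) (bij_g : bijective g) : Sym :=
  exist _ (g : {ptws nat -> nat}) (mem_set bij_g).

Definition sym_one : Sym := mk_sym (Bijective (frefl id) (frefl id)).
Definition sym_mul (g h : Sym) : Sym := mk_sym (bij_comp (sym_bij g) (sym_bij h)).

Lemma sym_inv_subproof (g : Sym) :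
  exists g' : nat -> nat, cancel g g' /\ cancel g' g.
Proof. by case: (sym_bij g) => g' gK g'K; exists g'. Qed.

Definition sym_inv_fun (g : Sym) : nat -> nat :=
  projT1 (cid (sym_inv_subproof g)).

Lemma symK (g : Sym) : cancel g (sym_inv_fun g).
Proof. by rewrite /sym_inv_fun; case: cid => ? []. Qed.

Lemma symKV (g : Sym) : cancel (sym_inv_fun g) g.
Proof. by rewrite /sym_inv_fun; case: cid => ? []. Qed.

Definition sym_inv (g : Sym) : Sym := mk_sym (Bijective (symKV g) (symK g)).

Lemma sym_mulA : associative sym_mul.
Proof. by move=> g h k; exact: sym_eqP. Qed.

Lemma sym_mul1 : left_id sym_one sym_mul.
Proof. by move=> g; exact: sym_eqP. Qed.

Lemma sym_mulr1 : right_id sym_one sym_mul.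
Proof. by move=> g; exact: sym_eqP. Qed.

Lemma sym_mulV : left_inverse sym_one sym_inv sym_mul.
Proof. by move=> g; apply: sym_eqP => x; exact: symK. Qed.

Lemma sym_mulrV : right_inverse sym_one sym_inv sym_mul.
Proof. by move=> g; apply: sym_eqP => x; exact: symKV. Qed.

HB.instance Definition _ := isGroup.Build Sym
  sym_mulA sym_mul1 sym_mulr1 sym_mulV sym_mulrV.

Lemma symM (g h : Sym) (x : nat) : (g * h : Sym) x = g (h x).
Proof. by []. Qed.

Lemma sym1 (x : nat) : (1 : Sym) x = x.
Proof. by []. Qed.

Lemma symVK (g : Sym) (x : nat) : (g^-1 : Sym) (g x) = x.
Proof. exact: symK. Qed.

Lemma symKVg (g : Sym) (x : nat) : g ((g^-1 : Sym) x) = x.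
Proof. exact: symKV. Qed.

Section Automorphisms.
Variables (L : signature) (M : structure L nat).

Definition automorphism : set Sym := [set g | isomorphism M M g].

Lemma automorphism1 : automorphism 1.
Proof. by split=> //; exact: sym_bij. Qed.

Lemma automorphismM (g h : Sym) :
  automorphism g -> automorphism h -> automorphism (g * h).
Proof.
move=> [_ gf gr] [_ hf hr]; split; first exact: sym_bij.
- by move=> f a; rewrite symM hf gf.
- by move=> r a; rewrite hr gr.
Qed.

Lemma automorphismV (g : Sym) : automorphism g -> automorphism g^-1.
Proof.
move=> [_ gf gr]; have gK n (a : 'I_n -> nat) : g \o (sym_fun g^-1 \o a) = a.
  by apply/funext => i; exact: symKVg.
split; first exact: sym_bij.
- move=> f a; rewrite -{1}(gK _ a) -gf; exact: symVK.
- by move=> r a; rewrite -{1}(gK _ a); exact: iff_sym (gr _ _).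
Qed.

Definition Aut : Type := automorphism.

HB.instance Definition _ := Topological.on Aut.
HB.instance Definition _ := SubChoice.on Aut.

Lemma automorphism_group_closed :
  group_closed (fun g : Sym => g \in automorphism).
Proof.
split; first exact/mem_set/automorphism1.
move=> g h /set_mem ga /set_mem ha.
exact/mem_set/automorphismM/automorphismV.
Qed.

HB.instance Definition _ := SubChoice_isSubGroup.Build Sym
  (fun g => g \in automorphism) Aut automorphism_group_closed.

End Automorphisms.

Definition same_orbit (L : signature) (M : structure L nat) (n : nat)
    (a b : 'I_n -> nat) : Prop :=
  exists2 g : Sym, automorphism M g & g \o a = b.

(** One relation symbol of arity [n + n] for each [n > 0]. *)
Definition orbital_signature : signature :=
  @Signature void (fun _ => 0)
    {n : nat | 0 < n} (fun n => sval n + sval n).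

(** The first [n] arguments of the [n]-th relation form the left tuple and the
    last [n] the right one. *)
Definition orbital_structure (L : signature) (M : structure L nat) :
    structure orbital_signature nat :=
  @Structure orbital_signature nat
    (fun f => match f with end)
    (fun n (c : 'I_(sval n + sval n) -> nat) =>
       same_orbit M (fun i => c (lshift (sval n) i))
                    (fun i => c (rshift (sval n) i))).

Section OrbitalQuotient.
Variables (L : signature) (M : structure L nat).

Lemma same_orbit_aut (g : Sym) (n : nat) (a b : 'I_n -> nat) :
  automorphism M g -> same_orbit M a b -> same_orbit M (g \o a) (g \o b).
Proof.
move=> ag [k ak <-]; exists (g * (k * g^-1)).
  by apply: automorphismM => //; apply: automorphismM => //; exact: automorphismV.
by apply/funext => i /=; rewrite !symM symVK.
Qed.

Lemma automorphism_orbital (g : Sym) :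
  automorphism M g -> automorphism (orbital_structure M) g.
Proof.
move=> ag; split; [exact: sym_bij | by case | move=> n c].
split; first exact: same_orbit_aut.
move=> /(same_orbit_aut (automorphismV ag)) /=.
by congr same_orbit; apply/funext => i /=; rewrite symVK.
Qed.

Lemma orbital_same_orbit (g : Sym) (n : nat) (a b : 'I_n.+1 -> nat) :
  automorphism (orbital_structure M) g ->
  same_orbit M a b <-> same_orbit M (g \o a) (g \o b).
Proof.
move=> [_ _ gr].
pose c (i : 'I_(n.+1 + n.+1)) :=
  match fintype.split i with inl j => a j | inr j => b j end.
have cl : (fun i => c (lshift n.+1 i)) = a.
  by apply/funext => i; rewrite /c (unsplitK (inl i)).
have cr : (fun i => c (rshift n.+1 i)) = b.
  by apply/funext => i; rewrite /c (unsplitK (inr i)).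
by rewrite -cl -cr; exact: (gr (exist _ n.+1 isT) c).
Qed.

Lemma extend_comp (g : nat -> nat) (n d : nat) (a : 'I_n -> nat) :
  g \o extend d a = extend (g d) (g \o a).
Proof. by apply/funext => i /=; rewrite /extend; case: unlift. Qed.

Lemma extend_inj (n d d' : nat) (a a' : 'I_n -> nat) :
  extend d a = extend d' a' -> d = d' /\ a = a'.
Proof.
move=> e; split.
  by have := congr1 (fun f => f ord0) e; rewrite /extend unlift_none.
by apply/funext => i; have := congr1 (fun f => f (lift ord0 i)) e;
   rewrite /extend liftK.
Qed.

Lemma automorphism_same_orbit (g : Sym) :
  (forall (n : nat) (a : 'I_n.+1 -> nat), same_orbit M a (g \o a)) ->
  automorphism M g.
Proof.
move=> og; split; first exact: sym_bij.
- move=> f a; have [k [_ kf _]] := og _ (extend (fun_int M a) a).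
  by rewrite !extend_comp => /extend_inj[<- <-]; rewrite kf.
- move=> r a; have [k [_ _ kr]] := og _ (extend 0 a).
  by rewrite !extend_comp => /extend_inj[_ <-].
Qed.

Definition Aut_orbital : preTopologicalGroupType := Aut (orbital_structure M).

Definition Aut_in_orbital : set Aut_orbital :=
  [set g | automorphism M (\val g)].

Lemma Aut_in_orbital1 : Aut_in_orbital 1.
Proof. exact: automorphism1. Qed.

Lemma Aut_in_orbitalM (g h : Aut_orbital) :
  Aut_in_orbital g -> Aut_in_orbital h -> Aut_in_orbital (g * h).
Proof. exact: automorphismM. Qed.

Lemma Aut_in_orbitalV (g : Aut_orbital) :
  Aut_in_orbital g -> Aut_in_orbital g^-1.
Proof. exact: automorphismV. Qed.

Lemma Aut_in_orbitalJ (h g : Aut_orbital) :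
  Aut_in_orbital h -> Aut_in_orbital (h ^ g).
Proof.
move=> ah; apply: automorphism_same_orbit => n a.
have ag : automorphism (orbital_structure M) (\val g) := set_valP g.
apply/(orbital_same_orbit _ _ ag); exists (\val h) => //.
by apply/funext => i /=; rewrite [in RHS]/sym_fun /=; exact/esym/symKVg.
Qed.

(** [Aut M] as a normal subgroup of [Aut (orbital_structure M)]. *)
Definition Aut_normal : normal_subgroup Aut_orbital :=
  NormalSubgroup Aut_in_orbital1 Aut_in_orbitalM Aut_in_orbitalV
    Aut_in_orbitalJ.

Definition orbital_quotient : preTopologicalGroupType :=
  quotient_group Aut_normal.

End OrbitalQuotient.

(* Main.v *)
Require Import Defs.
From HB Require Import structures.
From mathcomp Require Import all_boot zify.
From mathcomp Require Import boolp classical_sets functions cardinality.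
From mathcomp Require Import topology.

(** Ryll-Nardzewski: [M] being the only countable model of its theory, every
    finitely satisfiable type is realized in [M] and every non-isolated type is
    omitted in [M]; hence every type is isolated, there are finitely many
    [n]-types, and a back-and-forth argument identifies them with the orbits of
    [Aut M] on [n]-tuples.  Both kinds of countable model are limits, along an
    ultrafilter, of assignments [nat -> M] that provide witnesses for all
    formulas; for omitting types the ultrafilter avoids the type because the
    tuples occurring in finitely many witnessing conditions form a definable set.

    A basis of neighbourhoods of a coset [u] in the quotient consists of the
    clopen sets of all [v] such that [u (0, ..., n-1)] and [v (0, ..., n-1)] lie
    in the same orbit of [Aut M].  Given an ultrafilter on the quotient, the
    relation "[u b] is in the orbit of [c] for almost all [u]" has the
    back-and-forth property, as there are finitely many orbits, and the
    bijection obtained from it is a limit.  In a finite signature, a coset is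
    determined by its action on the orbits of bounded arity, hence by the orbit
    of the image of one tuple containing representatives of these orbits. *)

Set Implicit Arguments.
Unset Strict Implicit.
Unset Printing Implicit Defensive.

Local Open Scope classical_set_scope.

(* [topology] exports another [eval]. *)
Local Notation eval := Defs.eval.

(** * Definable sets *)

Lemma comp_extend (D D' : Type) (h : D -> D') (n : nat) (d : D) (a : 'I_n -> D) :
  h \o extend d a = extend (h d) (h \o a).
Proof. by apply/funext => i; rewrite /extend /=; case: unlift. Qed.

Lemma extend0 (D : Type) (n : nat) (d : D) (a : 'I_n -> D) :
  extend d a ord0 = d.
Proof. by rewrite /extend unlift_none. Qed.

Lemma extend_lift (D : Type) (n : nat) (d : D) (a : 'I_n -> D) (i : 'I_n) :
  extend d a (lift ord0 i) = a i.
Proof. by rewrite /extend liftK. Qed.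

Lemma extend_eta (D : Type) (n : nat) (a : 'I_n.+1 -> D) :
  extend (a ord0) (a \o lift ord0) = a.
Proof.
by apply/funext => i; case: (unliftP ord0 i) => [j|] ->;
  rewrite ?extend_lift ?extend0.
Qed.

Section Isomorphisms.
Variables (L : signature) (D D' : Type) (M : structure L D) (N : structure L D').
Variables (h : D -> D') (iso_h : isomorphism M N h).

Lemma isomorphism_eval (n : nat) (t : term L n) (a : 'I_n -> D) :
  h (eval M a t) = eval N (h \o a) t.
Proof.
have [_ hf _] := iso_h.
elim: t => [//|f ts IH] /=; rewrite hf; congr fun_int; apply/funext => i.
exact: IH.
Qed.

Lemma isomorphism_sat (n : nat) (phi : formula L n) (a : 'I_n -> D) :
  sat M phi a <-> sat N phi (h \o a).
Proof.
have [bij_h _ hr] := iso_h.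
elim: phi a => [//|{}n t u|{}n r ts|{}n p IHp q IHq|{}n p IHp] a /=.
- rewrite -!isomorphism_eval; split=> [->//|]; exact: bij_inj.
- rewrite hr; suff -> : h \o (fun i => eval M a (ts i)) =
    (fun i => eval N (h \o a) (ts i)) by [].
  by apply/funext => i; exact: isomorphism_eval.
- by rewrite IHp IHq.
- have [h' hK h'K] := bij_h.
  split=> Hp d; last by apply/IHp; rewrite comp_extend.
  by rewrite -[d]h'K -comp_extend; apply/IHp.
Qed.

End Isomorphisms.

Section Definability.
Variables (L : signature) (D : Type) (M : structure L D).

Fixpoint rename_term (n m : nat) (f : 'I_n -> 'I_m) (t : term L n) : term L m :=
  match t with
  | Var i => Var L (f i)
  | App g ts => App (fun i => rename_term f (ts i))
  end.

(** Phrased through [extend] so that [comp_extend] also computes its composite with an extended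
    assignment. *)
Definition lift_renaming (n m : nat) (f : 'I_n -> 'I_m) : 'I_n.+1 -> 'I_m.+1 :=
  extend ord0 (lift ord0 \o f).

Fixpoint rename (n : nat) (phi : formula L n) :
    forall m, ('I_n -> 'I_m) -> formula L m :=
  match phi with
  | Falsum _ => fun m f => Falsum L m
  | Equal _ t u => fun m f => Equal (rename_term f t) (rename_term f u)
  | Rel _ r ts => fun m f => Rel (fun i => rename_term f (ts i))
  | Imp _ p q => fun m f => Imp (rename p f) (rename q f)
  | Forall _ p => fun m f => Forall (rename p (lift_renaming f))
  end.

Lemma eval_rename (n m : nat) (f : 'I_n -> 'I_m) (t : term L n) (a : 'I_m -> D) :
  eval M a (rename_term f t) = eval M (a \o f) t.
Proof. by elim: t => [//|g ts IH] /=; congr fun_int; apply/funext. Qed.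

Lemma sat_rename (n : nat) (phi : formula L n) (m : nat) (f : 'I_n -> 'I_m)
    (a : 'I_m -> D) :
  sat M (rename phi f) a <-> sat M phi (a \o f).
Proof.
elim: phi m f a => [//|{}n t u|{}n r ts|{}n p IHp q IHq|{}n p IHp] m f a /=.
- by rewrite !eval_rename.
- suff -> : (fun i => eval M a (rename_term f (ts i))) =
    (fun i => eval M (a \o f) (ts i)) by [].
  by apply/funext => i; rewrite eval_rename.
- by rewrite IHp IHq.
- have E d : extend d a \o lift_renaming f = extend d (a \o f).
    rewrite /lift_renaming comp_extend extend0; congr extend.
    by apply/funext => i /=; rewrite extend_lift.
  by split=> H d; move: (H d); rewrite IHp E.
Qed.

Lemma eq_definable (n : nat) (R S : set ('I_n -> D)) :
  (forall a, R a <-> S a) -> definable M R -> definable M S.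
Proof. by move=> RS [phi H]; exists phi => a; rewrite -RS. Qed.

Lemma definable_sat (n : nat) (phi : formula L n) : definable M (sat M phi).
Proof. by exists phi. Qed.

Lemma definable_rename (n m : nat) (f : 'I_n -> 'I_m) (R : set ('I_n -> D)) :
  definable M R -> definable M [set a : 'I_m -> D | R (a \o f)].
Proof. by move=> [phi H]; exists (rename phi f) => a; rewrite sat_rename -H. Qed.

Lemma definable_imp (n : nat) (R S : set ('I_n -> D)) :
  definable M R -> definable M S -> definable M [set a | R a -> S a].
Proof. by move=> [p Hp] [q Hq]; exists (Imp p q) => a /=; rewrite Hp Hq. Qed.

Lemma definable_false (n : nat) : definable M (set0 : set ('I_n -> D)).
Proof. by exists (Falsum L n). Qed.

Lemma definable_true (n : nat) : definable M (setT : set ('I_n -> D)).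
Proof. by exists (Imp (Falsum L n) (Falsum L n)) => a; split=> // _ H; exact: H. Qed.

Lemma definableC (n : nat) (R : set ('I_n -> D)) :
  definable M R -> definable M (~` R).
Proof. by move=> dR; exact: (definable_imp dR (definable_false n)). Qed.

Lemma definableI (n : nat) (R S : set ('I_n -> D)) :
  definable M R -> definable M S -> definable M (R `&` S).
Proof.
move=> dR dS; apply: eq_definable (definableC (definable_imp dR (definableC dS))).
move=> a; split=> [/not_implyP[Ra /contrapT]//|[Ra Sa] H]; exact: H.
Qed.

Lemma definable_eq (n : nat) (i j : 'I_n) : definable M [set a : 'I_n -> D | a i = a j].
Proof. by exists (Equal (Var L i) (Var L j)). Qed.

Lemma definable_forall (n : nat) (R : set ('I_n.+1 -> D)) :
  definable M R -> definable M [set a | forall d, R (extend d a)].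
Proof.
move=> [p Hp]; exists (Forall p) => a /=.
by split=> H d; move: (H d); rewrite Hp.
Qed.

Lemma definable_exists (n : nat) (R : set ('I_n.+1 -> D)) :
  definable M R -> definable M [set a | exists d, R (extend d a)].
Proof.
move=> /definableC/definable_forall/definableC; apply: eq_definable => a.
by split=> [/existsNP[d /contrapT]|[d Rd] H]; [exists d | exact: (H d)].
Qed.

Lemma definable_bigcap (n k : nat) (R : 'I_k -> set ('I_n -> D)) :
  (forall j, definable M (R j)) -> definable M [set a | forall j, R j a].
Proof.
elim: k R => [|k IH] R dR.
  by apply: eq_definable (definable_true n) => a; split=> // _ [].
have := definableI (dR ord0) (IH _ (fun j => dR (lift ord0 j))).
apply: eq_definable => a; split=> [[R0 RS] j|H]; last by split=> [|j]; exact: H.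
by case: (unliftP ord0 j) => [i|] ->; [exact: RS | exact: R0].
Qed.

(** Induction on [m]: one existential quantifier removes coordinate 0, the first of those to be
    forgotten. *)
Lemma definable_projection (m n : nat) (R : set ('I_(m + n) -> D)) :
  definable M R ->
  definable M [set e : 'I_n -> D | exists2 a, R a & a \o @rshift m n = e].
Proof.
elim: m R => [|m IH] R dR.
  apply: eq_definable dR => e; split=> [Re|[a Ra <-]].
    by exists e => //; apply/funext => i /=; congr e; exact: val_inj.
  suff -> : a \o @rshift 0 n = a by [].
  by apply/funext => i /=; congr a; exact: val_inj.
have shiftS d (a : 'I_(m + n) -> D) : extend d a \o @rshift m.+1 n = a \o @rshift m n.
  apply/funext => i /=; rewrite -(extend_lift d a).
  by congr extend; exact: val_inj.
have := IH _ (definable_exists (n := m + n) dR); apply: eq_definable => e; split.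
- by move=> [a [d Ra] <-]; exists (extend d a) => //; rewrite shiftS.
- move=> [a Ra <-]; exists (a \o lift (ord0 : 'I_(m + n).+1)).
    by exists (a ord0); rewrite extend_eta.
  by rewrite -(shiftS (a ord0)) (extend_eta (n := m + n)).
Qed.

(** On tuples of length [m + n] it is definable that the left block lies in [R] and that the right
    block is its reindexing by [f]; the left block is then projected away. *)
Lemma definable_image (m n : nat) (f : 'I_n -> 'I_m) (R : set ('I_m -> D)) :
  definable M R -> definable M [set e : 'I_n -> D | exists2 b, R b & b \o f = e].
Proof.
move=> dR.
have := definable_projection (definableI (definable_rename (@lshift m n) dR)
  (definable_bigcap (fun i => definable_eq (lshift n (f i)) (rshift m i)))).
apply: eq_definable => e; split.
- by move=> [a [Ra aE] <-]; exists (a \o @lshift m n) => //; apply/funext.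
- move=> [b Rb <-].
  pose a (i : 'I_(m + n)) :=
    match fintype.split i with inl j => b j | inr j => b (f j) end.
  have al i : a (lshift n i) = b i by rewrite /a (unsplitK (inl i)).
  have ar i : a (rshift m i) = b (f i) by rewrite /a (unsplitK (inr i)).
  exists a; last by apply/funext.
  split=> /=; last by move=> i; rewrite /= al ar.
  by suff -> : a \o @lshift m n = b by []; apply/funext.
Qed.

End Definability.

Lemma isomorphism_definable (L : signature) (D : Type) (M : structure L D)
    (h : D -> D) (n : nat) (R : set ('I_n -> D)) (a : 'I_n -> D) :
  isomorphism M M h -> definable M R -> R a <-> R (h \o a).
Proof. by move=> iso_h [phi H]; rewrite !H; exact: isomorphism_sat. Qed.

(** * Back-and-forth and countability of formulas *)

Section BackAndForth.
Variable P : forall n, ('I_n -> nat) -> ('I_n -> nat) -> Prop.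
Hypothesis P_comp : forall n m (f : 'I_m -> 'I_n) b c,
  P b c -> P (b \o f) (c \o f).
Hypothesis P_inj : forall b c : 'I_2 -> nat, P b c ->
  b ord0 = b ord_max <-> c ord0 = c ord_max.
Hypothesis P_forth : forall n (b c : 'I_n -> nat), P b c ->
  forall d, exists e, P (extend d b) (extend e c).
Hypothesis P_back : forall n (b c : 'I_n -> nat), P b c ->
  forall e, exists d, P (extend d b) (extend e c).

(** A finite partial map is a pair of tuples, possibly with repetitions; [P_comp] and [P_inj] make
    it single-valued and injective. *)
Record partial_map := PartialMap {
  pm_size : nat;
  pm_dom : 'I_pm_size -> nat;
  pm_img : 'I_pm_size -> nat;
  pm_rel : P pm_dom pm_img }.
Arguments pm_dom : clear implicits.
Arguments pm_img : clear implicits.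

Definition pm_sub (s t : partial_map) : Prop :=
  exists f : 'I_(pm_size s) -> 'I_(pm_size t),
    pm_dom s = pm_dom t \o f /\ pm_img s = pm_img t \o f.

Definition pm_graph (s : partial_map) (x y : nat) : Prop :=
  exists i, pm_dom s i = x /\ pm_img s i = y.

Lemma pm_sub_trans (s t u : partial_map) : pm_sub s t -> pm_sub t u -> pm_sub s u.
Proof.
by move=> [f [E E']] [g [F F']]; exists (g \o f); rewrite E E' F F'.
Qed.

Lemma pm_sub_graph (s t : partial_map) (x y : nat) :
  pm_sub s t -> pm_graph s x y -> pm_graph t x y.
Proof. by move=> [f [E E']] [i [<- <-]]; exists (f i); rewrite E E'. Qed.

Lemma pm_step (s : partial_map) (d : nat) : exists t, pm_sub s t /\
  (exists e, pm_graph t d e) /\ (exists e, pm_graph t e d).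
Proof.
case: s => n b c Pbc.
have [e Pe] := P_forth Pbc d; have [d' Pd'] := P_back Pe d.
exists (PartialMap Pd'); split; last split.
- exists (lift ord0 \o lift ord0) => /=.
  by split; apply/funext => i /=; rewrite !extend_lift.
- by exists e, (lift ord0 ord0); rewrite /= !extend_lift !extend0.
- by exists d', ord0; rewrite /= !extend0.
Qed.

(** The map is the union of a chain in which stage [d.+1] has [d] in its domain and in its image.
    Every finite part of the union occurs at one stage, so it inherits [P] by [P_comp]. *)
Lemma back_and_forth (n : nat) (b c : 'I_n -> nat) : P b c ->
  exists h : nat -> nat, [/\ bijective h, h \o b = c &
    forall m (a : 'I_m -> nat), P a (h \o a)].
Proof.
move=> Pbc.
pose next s d := projT1 (cid (pm_step s d)).
have nextP s d := projT2 (cid (pm_step s d)).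
pose st := fix st k := if k is k'.+1 then next (st k') k' else PartialMap Pbc.
have st_sub j k : j <= k -> pm_sub (st j) (st k).
  elim: k => [|k IH]; first by rewrite leqn0 => /eqP ->; exists id.
  rewrite leq_eqVlt ltnS => /predU1P[->|/IH jk]; first by exists id.
  by apply: pm_sub_trans jk _; have [] := nextP (st k) k.
have dom x : exists y, pm_graph (st x.+1) x y by have [_ []] := nextP (st x) x.
have [h hP] := choice dom.
have img y : exists x, pm_graph (st y.+1) x y by have [_ []] := nextP (st y) y.
(* Tuples matched by the graph of stage [K] are reindexings of its two tuples along one and the same
   map. *)
have common K m (a a' : 'I_m -> nat) :
    (forall i, pm_graph (st K) (a i) (a' i)) -> P a a'.
  move=> /choice[f fP].
  have -> : a = pm_dom (st K) \o f by apply/funext => i; case: (fP i).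
  have -> : a' = pm_img (st K) \o f by apply/funext => i; case: (fP i).
  exact/P_comp/pm_rel.
have inj K x y x' y' : pm_graph (st K) x y -> pm_graph (st K) x' y' ->
    x = x' <-> y = y'.
  move=> g g'; have /P_inj : P (extend x (fun _ : 'I_1 => x'))
                                (extend y (fun _ : 'I_1 => y')).
    apply: (common K) => i; case: (unliftP ord0 i) => [j|] ->.
      by rewrite !extend_lift.
    by rewrite !extend0.
  rewrite !extend0 (_ : ord_max = lift ord0 ord0); last exact: val_inj.
  by rewrite !extend_lift.
have hK K x : x < K -> pm_graph (st K) x (h x).
  by move=> xK; apply: pm_sub_graph (st_sub _ _ xK) (hP x).
have h_inj : injective h.
  by move=> x x'; apply: (inj (maxn x x').+1 _ _ _ _ _ _).2; apply: hK; lia.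
have h_surj y : exists x, h x = y.
  have [x xy] := img y; exists x.
  apply: (inj (maxn x y).+1 x _ x _ _ _).1 => //; first by apply: hK; lia.
  by apply: pm_sub_graph xy; apply: st_sub; lia.
have [h' h'K] := choice h_surj.
exists h; split; first by exists h' => // x; exact: h_inj.
- apply/funext => i /=; apply: (inj (b i).+1 (b i) _ (b i) _ _ _).1 => //.
  by apply: (@pm_sub_graph (st 0)); [exact: st_sub | exists i].
- move=> m a; apply: (common (\max_i a i).+1) => i; apply: hK.
  by rewrite ltnS; exact: leq_bigmax.
Qed.

End BackAndForth.

(** * Injective codes of terms and formulas *)

Section Countability.
Variables (L : signature) (cf : fun_sym L -> nat) (cr : rel_sym L -> nat).
Hypotheses (cf_inj : injective cf) (cr_inj : injective cr).

Definition code_tuple (k : nat) (c : 'I_k -> nat) : seq nat :=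
  [seq c i | i <- enum 'I_k].

Lemma code_tuple_inj (k : nat) : injective (@code_tuple k).
Proof.
move=> c c' /eq_in_map E; apply/funext => i; apply: E.
by rewrite mem_enum.
Qed.

Fixpoint code_term (n : nat) (t : term L n) : nat :=
  match t with
  | Var i => pickle (0, [:: val i])
  | App f ts => pickle ((cf f).+1, code_tuple (fun i => code_term (ts i)))
  end.

Lemma code_term_inj (n : nat) : injective (@code_term n).
Proof.
elim=> [i|f ts IH] [j|g us] //= /(pcan_inj pickleK) [] //.
- by move=> /val_inj ->.
- move=> /cf_inj E; case: _ / E us => us /code_tuple_inj E.
  by congr App; apply/funext => i; apply: IH; exact: (congr1 (@^~ i) E).
Qed.

(** The tags 0 to 3 belong to the other constructors, so the tags of [Rel], which contain the
    symbol, start at 4. *)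
Fixpoint code_formula (n : nat) (phi : formula L n) : nat :=
  match phi with
  | Falsum _ => pickle (0, [::] : seq nat)
  | Equal _ t u => pickle (1, [:: code_term t; code_term u])
  | Imp _ p q => pickle (2, [:: code_formula p; code_formula q])
  | Forall _ p => pickle (3, [:: code_formula p])
  | Rel _ r ts => pickle ((cr r).+4, code_tuple (fun i => code_term (ts i)))
  end.

Lemma code_formula_inj (n : nat) : injective (@code_formula n).
Proof.
elim=> {n} [n|n t u|n r ts|n p IHp q IHq|n p IHp] psi.
- by case: psi => [//|{}n t u|{}n r ts|{}n p q|{}n p] /= /(pcan_inj pickleK).
- move: t u; case: psi => [n'|n' t' u'|n' r ts|n' p q|n' p] t u /= /(pcan_inj pickleK) //.
  by case=> /code_term_inj -> /code_term_inj ->.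
- move: ts; case: psi => [n'|n' t u|n' r' us|n' p q|n' p] ts /= /(pcan_inj pickleK) //.
  case=> /cr_inj E; case: _ / E us => us /code_tuple_inj E.
  by congr Rel; apply/funext => i; apply: code_term_inj; exact: (congr1 (@^~ i) E).
- move: p q IHp IHq.
  case: psi => [n'|n' t u|n' r us|n' p' q'|n' p'] p q IHp IHq /= /(pcan_inj pickleK) //.
  by case=> /IHp -> /IHq ->.
- move: p IHp.
  case: psi => [n'|n' t u|n' r us|n' p' q'|n' p'] p IHp /= /(pcan_inj pickleK) //.
  by case=> /IHp ->.
Qed.

End Countability.

(** * Limits of Henkin assignments *)

Lemma injective_enum (T : Type) (x0 : T) (f : T -> nat) :
  injective f -> exists e : nat -> T, cancel f e.
Proof.
move=> f_inj.
have H k : exists x, (exists y, f y = k) -> f x = k.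
  have [[y yk]|no] := pselect (exists y, f y = k); first by exists y.
  by exists x0 => /no.
have [e eP] := choice H; exists e => x.
by apply: f_inj; apply: eP; exists x.
Qed.

Lemma countable_injection (T : Type) :
  countable [set: T] -> exists f : T -> nat, injective f.
Proof.
move=> /countable_injP[f f_inj]; exists f => x y.
by apply: f_inj; rewrite in_setT.
Qed.

(** The list [pre k] holds the first [k] values. Read with default 0 beyond its end, it agrees with
    the solution below [k], and [F _ k] depends on nothing else. *)
Lemma course_of_values (F : (nat -> nat) -> nat -> nat) :
  (forall k a b, (forall j, j < k -> a j = b j) -> F a k = F b k) ->
  exists a, forall k, a k = F a k.
Proof.
move=> F_ext.
pose pre := fix pre k :=
  if k is k'.+1 then rcons (pre k') (F (nth 0 (pre k')) k') else [::].
have size_pre k : size (pre k) = k by elim: k => //= k IH; rewrite size_rcons IH.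
exists (fun k => F (nth 0 (pre k)) k) => k; apply: F_ext.
elim: k => // k IH j; rewrite ltnS leq_eqVlt => /predU1P[->|jk] /=.
  by rewrite nth_rcons size_pre ltnn eqxx.
by rewrite nth_rcons size_pre jk IH.
Qed.

Lemma ultrafilter_chain (T : Type) (C : nat -> set T) :
  (forall k, C k !=set0) -> (forall k, C k.+1 `<=` C k) ->
  exists F : set_system T, UltraFilter F /\ forall k, F (C k).
Proof.
move=> C0 CS.
have C_mono j k : j <= k -> C k `<=` C j.
  elim: k => [|k IH]; first by rewrite leqn0 => /eqP ->.
  rewrite leq_eqVlt ltnS => /predU1P[->//|/IH kj]; exact: subset_trans (CS k) kj.
have FF : ProperFilter [set A | exists k, C k `<=` A].
  split; first by move=> [k Ck]; have [x /Ck] := C0 k.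
  split.
  - by exists 0.
  - move=> A B [j jA] [k kB]; exists (maxn j k) => x Cx; split.
      by apply: jA; apply: C_mono Cx; exact: leq_maxl.
    by apply: kB; apply: C_mono Cx; exact: leq_maxr.
  - by move=> A B AB [k kA]; exists k; exact: subset_trans AB.
have [G [UG FG]] := ultraFilterLemma FF.
by exists G; split=> // k; apply: FG; exists k.
Qed.

(** Otherwise all complements belong to [F], and a point in their finite intersection is not
    covered. *)
Lemma ultrafilter_finite_cover (T : Type) (F : set_system T) (k : nat)
    (A : 'I_k -> set T) :
  UltraFilter F -> (forall x, exists j, A j x) -> exists j, F (A j).
Proof.
move=> UF cov; apply: contrapT => /forallNP nA.
have : F [set x | forall j, ~ A j x].
  by apply: filter_forall => j; case: (in_ultra_setVsetC (A j) UF) => // /nA.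
by move=> /filter_ex[x Ax]; have [j /Ax] := cov x.
Qed.

(** * Henkin conditions and assignments that meet them *)

Section Witnesses.
Variables (L : signature) (M : structure L nat).

(** [Requirement phi i] asks for a variable [x_k], with [k] larger than all
    [i l], naming a witness of [exists y, phi(y, x_(i 0), x_(i 1), ...)]. *)
Record requirement := Requirement {
  req_size : nat;
  req_formula : formula L req_size.+1;
  req_tuple : 'I_req_size -> nat }.
Arguments req_tuple : clear implicits.

(** The guard makes the condition on [a k] refer to earlier values only, so that assignments can be
    built by recursion; a requirement that comes up too early is vacuous there. *)
Definition witnessed (r : requirement) (k : nat) : set (nat -> nat) :=
  [set a : nat -> nat | (forall l, req_tuple r l < k) ->
     (exists d, sat M (req_formula r) (extend d (a \o req_tuple r))) ->
     sat M (req_formula r) (extend (a k) (a \o req_tuple r))].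

(** Recurrence brings every requirement back at an index beyond its own variables and beyond any
    initial segment left free. *)
Definition recurring (enum_req : nat -> requirement) : Prop :=
  forall r m, exists2 k, m <= k & enum_req k = r.

Hypothesis countable_L : countable_signature L.

Lemma formula_code : exists c : forall n, formula L n -> nat,
  forall n, injective (c n).
Proof.
have [/countable_injection[f fI] /countable_injection[r rI]] := countable_L.
by exists (code_formula f r) => n; exact: code_formula_inj.
Qed.

Lemma recurring_enum : exists enum_req, recurring enum_req.
Proof.
have [c cI] := formula_code.
pose code (r : requirement) :=
  pickle (req_size r, c _ (req_formula r), code_tuple (req_tuple r)).
have code_inj : injective code.
  move=> [n p i] [m q j] /(pcan_inj pickleK) /= [nm].
  by case: _ / nm q j => q j /cI -> /code_tuple_inj ->.
have [e eK] := @injective_enum _ (@Requirement 0 (Falsum L 1) (fun _ => 0)) _ code_inj.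
(* [k |-> logn 2 k] takes every value infinitely often. *)
exists (fun k => e (logn 2 k)) => r m.
exists (2 ^ code r * m.*2.+1).
  have : 0 < 2 ^ code r by rewrite expn_gt0.
  by rewrite -mul2n; nia.
rewrite lognM ?expn_gt0 // pfactorK // [logn 2 m.*2.+1]logn_coprime ?addn0 //.
by rewrite coprime2n /= odd_double.
Qed.

Variable enum_req : nat -> requirement.

Definition henkin (k : nat) : set (nat -> nat) := witnessed (enum_req k) k.

(** From [n0] on, the value at [k] is a witness for the requirement treated at [k], if there is one;
    it is chosen in terms of earlier values, hence by course-of-values recursion. *)
Lemma henkin_extend (n0 : nat) (b : nat -> nat) : exists a : nat -> nat,
  (forall k, k < n0 -> a k = b k) /\ forall k, n0 <= k -> henkin k a.
Proof.
pose F (a : nat -> nat) k :=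
  let r := enum_req k in
  if k < n0 then b k else
  if `[< forall l, req_tuple r l < k >] then
    xget 0 [set d | sat M (req_formula r) (extend d (a \o req_tuple r))]
  else 0.
have [|a aP] := @course_of_values F.
  move=> k a a' aa'; rewrite /F /=; case: ifP => // _; case: asboolP => // lt_k.
  suff -> : a \o req_tuple (enum_req k) = a' \o req_tuple (enum_req k) by [].
  by apply/funext => l; exact: aa'.
exists a; split=> k kn; rewrite ?aP; first by rewrite /F kn.
move=> lt_k ex; rewrite aP /F ltnNge kn /= asboolT //.
exact: (xgetPex 0 ex).
Qed.

End Witnesses.

(** * The countable limit model along an ultrafilter *)

Section HenkinModel.
Local Open Scope quotient_scope.
Variables (L : signature) (M : structure L nat) (F : set_system (nat -> nat)).
Hypothesis (UF : UltraFilter F).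
Variables (enum_req : nat -> requirement L) (n0 : nat).
Hypotheses (rec_enum : recurring enum_req)
  (F_henkin : forall k, n0 <= k -> F (henkin M enum_req k)).

Lemma ultra_imp (A B : set (nat -> nat)) :
  (F A -> F B) <-> F [set a : nat -> nat | A a -> B a].
Proof.
split=> [AB|FAB FA]; last by apply: filterS2 FAB FA => a AB; exact: AB.
have [/AB FB|FnA] := in_ultra_setVsetC A UF; first by apply: filterS FB => a Ba _.
by apply: filterS FnA => a nAa Aa; case: (nAa Aa).
Qed.

Lemma ultra_witness (n : nat) (phi : formula L n.+1) (i : 'I_n -> nat) :
  exists k, F [set a : nat -> nat | (exists d, sat M phi (extend d (a \o i))) ->
                 sat M phi (a \o extend k i)].
Proof.
(* The bound puts [k] beyond [n0], so that the condition at [k] holds almost everywhere, and beyond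
   all [i l], so that its guard is satisfied. *)
have [k kn E] := rec_enum (Requirement phi i) (maxn n0 (\max_l (i l)).+1).
exists k; have k0 : n0 <= k by lia.
apply: filterS (F_henkin k0) => a; rewrite /henkin /witnessed /= E /=.
rewrite comp_extend; apply => l.
by have := @leq_bigmax _ i l; lia.
Qed.

(** The class of [i] stands for the coordinate function [a |-> a i] in the ultrapower of [M] along
    [F]. Only such classes are kept, so the domain is countable. *)
Definition germ_rel : rel nat := fun i j => `[< F [set a : nat -> nat | a i = a j] >].

Lemma germ_refl : reflexive germ_rel.
Proof. by move=> i; apply/asboolP; apply: filterS filterT => a. Qed.

Lemma germ_sym : symmetric germ_rel.
Proof.
by move=> i j; apply/asboolP/asboolP; apply: filterS => a /= ->.
Qed.

Lemma germ_trans : transitive germ_rel.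
Proof.
move=> j i k /asboolP ij /asboolP jk; apply/asboolP.
by apply: filterS2 ij jk => a /= ->.
Qed.

Definition germ_equiv := EquivRel germ_rel germ_refl germ_sym germ_trans.
Definition germ : Type := {eq_quot germ_equiv}.
Definition to_germ (i : nat) : germ := \pi_{eq_quot germ_equiv} i.
Definition of_germ (x : germ) : nat := repr (x : {eq_quot germ_equiv}).

Lemma of_germK : cancel of_germ to_germ.
Proof. by move=> x; rewrite /to_germ /of_germ reprK. Qed.

Lemma to_germP (i j : nat) : to_germ i = to_germ j <-> F [set a : nat -> nat | a i = a j].
Proof.
split=> [/eqmodP/asboolP//|Fij].
by apply/eqmodP; exact/asboolP.
Qed.

Lemma ultra_of_germ (n : nat) (i : 'I_n -> nat) :
  F [set a : nat -> nat | a \o (of_germ \o (to_germ \o i)) = a \o i].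
Proof.
have : F [set a : nat -> nat | forall l, a (of_germ (to_germ (i l))) = a (i l)].
  by apply: filter_forall => l; apply/to_germP; rewrite of_germK.
by apply: filterS => a aP; apply/funext.
Qed.

(** A value of a function is again the class of a coordinate by [ultra_fun], so the default 0 of
    [xget] is never taken. *)
Definition germ_structure : structure L germ := @Structure L germ
  (fun f x => to_germ (xget 0 [set k |
     F [set a : nat -> nat | fun_int M (a \o (of_germ \o x)) = a k]]))
  (fun r x => F [set a : nat -> nat | rel_int M (r := r) (a \o (of_germ \o x))]).

Lemma ultra_fun (f : fun_sym L) (i : 'I_(fun_ar f) -> nat) :
  exists k, F [set a : nat -> nat | fun_int M (a \o i) = a k].
Proof.
(* The formula [x_0 = f(x_1, ...)] always has a witness, and [k] names it. *)
have [k kP] := @ultra_witness _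
  (Equal (Var L ord0) (App (fun l => Var L (lift ord0 l)))) i.
exists k; apply: filterS kP => a; rewrite /mkset comp_extend /= => H.
have E d (j : 'I_(fun_ar f) -> nat) : (fun l => extend d j (lift ord0 l)) = j.
  by apply/funext => l; rewrite extend_lift.
move: H; rewrite !E !extend0 => -> //.
by exists (fun_int M (a \o i)); rewrite E extend0.
Qed.

Lemma germ_fun (f : fun_sym L) (i : 'I_(fun_ar f) -> nat) (k : nat) :
  F [set a : nat -> nat | fun_int M (a \o i) = a k] ->
  fun_int germ_structure (to_germ \o i) = to_germ k.
Proof.
move=> Fk; apply/to_germP.
have := xgetPex 0 (ultra_fun (of_germ \o (to_germ \o i))) => /= Fx.
by apply: filterS3 Fk Fx (ultra_of_germ i) => a /= <- <- ->.
Qed.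

Lemma germ_eval (n : nat) (t : term L n) (i : 'I_n -> nat) : exists k,
  eval germ_structure (to_germ \o i) t = to_germ k /\
  F [set a : nat -> nat | eval M (a \o i) t = a k].
Proof.
elim: t => [j|f ts /choice[ks ksP]].
  by exists (i j); split=> //; apply: filterS filterT.
have [k Fk] := ultra_fun ks; exists k; split.
  rewrite -(germ_fun Fk).
  suff -> : to_germ \o ks = (fun j => eval germ_structure (to_germ \o i) (ts j)) by [].
  by apply/funext => j; case: (ksP j).
have : F [set a : nat -> nat | forall j, eval M (a \o i) (ts j) = a (ks j)].
  by apply: filter_forall => j; case: (ksP j).
move=> Fks; apply: filterS2 Fk Fks => a /= <- aks.
by congr fun_int; apply/funext.
Qed.

(** This is the theorem of Łoś for the limit model: the ultrafilter property settles implications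
    and Henkin witnesses settle quantifiers. *)
Lemma germ_sat (n : nat) (phi : formula L n) (i : 'I_n -> nat) :
  sat germ_structure phi (to_germ \o i) <-> F [set a : nat -> nat | sat M phi (a \o i)].
Proof.
elim: phi i => {n} [n|n t u|n r ts|n p IHp q IHq|n p IHp] i /=.
- by split=> // /filter_ex[].
- have [j [-> Fj]] := germ_eval t i; have [k [-> Fk]] := germ_eval u i.
  rewrite to_germP; split=> H; first by apply: filterS3 Fj Fk H => a /= -> ->.
  by apply: filterS3 Fj Fk H => a /= <- <-.
- have [ks ksP] := choice (fun j => germ_eval (ts j) i).
  have -> : (fun l => eval germ_structure (to_germ \o i) (ts l)) = to_germ \o ks.
    by apply/funext => j; case: (ksP j).
  have Fts : F [set a : nat -> nat | (fun l => eval M (a \o i) (ts l)) = a \o ks].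
    have : F [set a : nat -> nat | forall l, eval M (a \o i) (ts l) = a (ks l)].
      by apply: filter_forall => j; case: (ksP j).
    by apply: filterS => a aP; apply/funext.
  split=> H; first by apply: filterS3 Fts (ultra_of_germ ks) H => a /= -> ->.
  by apply: filterS3 Fts (ultra_of_germ ks) H => a /= -> ->.
- by rewrite IHp IHq; exact: ultra_imp.
- split=> [H|Fp d]; last first.
    rewrite -[d]of_germK -comp_extend; apply/IHp; apply: filterS Fp => a /= Hp.
    by rewrite comp_extend.
  (* The variable [k] names a counterexample to [p] whenever there is one, so [p] at [k] implies [p]
     everywhere. *)
  have [k kP] := ultra_witness (Imp p (Falsum L n.+1)) i.
  have /IHp Fk : sat germ_structure p (to_germ \o extend k i).
    by rewrite comp_extend; exact: H.
  apply: filterS2 kP Fk => a /= kP pk d; apply: contrapT => npd.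
  by apply: kP => //; exists d.
Qed.

(** If finitely many classes were all, a variable witnessing the formula that excludes each of them
    would give a further class. *)
Lemma germ_countably_infinite : countably_infinite germ.
Proof.
apply: eq_card_nat.
  by apply/countable_injP; exists of_germ => x y _ _ /(can_inj of_germK).
move=> /(finite_seqP (T := {eq_quot germ_equiv}))[s sT].
pose i (l : 'I_(size s)) := of_germ (tnth (in_tuple s) l).
have [phi phiP] : definable M [set b : 'I_(size s).+1 -> nat |
    forall l, b ord0 <> b (lift ord0 l)].
  by apply: definable_bigcap => l; apply: definableC; exact: definable_eq.
have [k kP] := ultra_witness phi i.
have fresh a : exists d, sat M phi (extend d (a \o i)).
  exists (\max_l a (i l)).+1; apply/phiP => l; rewrite extend0 extend_lift /=.
  by have := @leq_bigmax _ (fun l => a (i l)) l => /= le_l eq_l;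
    move: le_l; rewrite -eq_l ltnn.
have /tnthP[l kl] : (to_germ k : {eq_quot germ_equiv}) \in in_tuple s.
  by have : [set: {eq_quot germ_equiv}] (to_germ k) by []; rewrite sT.
have /to_germP Fk : to_germ k = to_germ (i l) by rewrite /i -kl of_germK.
have [a []] := filter_ex (filterI Fk kP).
by move=> /= akl /(_ (fresh a))/phiP/(_ l); rewrite comp_extend extend0 extend_lift.
Qed.

Lemma germ_models : models germ_structure (Th M).
Proof.
move=> phi Mphi a.
have -> : a = to_germ \o (fun _ => 0) by apply/funext => -[].
by apply/germ_sat; apply: filterS filterT => b _; exact: Mphi.
Qed.

End HenkinModel.

(** * The Ryll-Nardzewski theorem *)

Definition pad (n : nat) (b : 'I_n -> nat) (k : nat) : nat :=
  if insub k is Some i then b i else 0.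

Lemma pad_val (n : nat) (b : 'I_n -> nat) : pad b \o val = b.
Proof. by apply/funext => i; rewrite /pad /= valK. Qed.

(** * Definable conditions on initial segments of assignments *)

Section Supported.
Variables (L : signature) (M : structure L nat).

Definition supported (m : nat) (A : set (nat -> nat)) : Prop :=
  exists2 R : set ('I_m -> nat), definable M R & forall a, A a <-> R (a \o val).

Lemma supported_true (m : nat) : supported m setT.
Proof. by exists setT; first exact: definable_true. Qed.

Lemma supported_imp (m : nat) (A B : set (nat -> nat)) :
  supported m A -> supported m B -> supported m [set a | A a -> B a].
Proof.
move=> [R dR AR] [S dS BS]; exists [set b | R b -> S b] => [|a /=].
  exact: definable_imp.
by rewrite AR BS.
Qed.

Lemma supportedI (m : nat) (A B : set (nat -> nat)) :
  supported m A -> supported m B -> supported m (A `&` B).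
Proof.
move=> [R dR AR] [S dS BS]; exists (R `&` S) => [|a].
  exact: definableI.
by rewrite /setI /= AR BS.
Qed.

Lemma supportedC (m : nat) (A : set (nat -> nat)) :
  supported m A -> supported m (~` A).
Proof.
move=> [R dR AR]; exists (~` R) => [|a]; first exact: definableC.
by rewrite /setC /= AR.
Qed.

Lemma supported_bigcap (m k : nat) (A : 'I_k -> set (nat -> nat)) :
  (forall j, supported m (A j)) -> supported m [set a | forall j, A j a].
Proof.
move=> sA; have [R RP] := choice (fun j => let: ex_intro2 R dR AR := sA j in
  ex_intro (fun R => definable M R /\ forall a, A j a <-> R (a \o val)) R (conj dR AR)).
exists [set b | forall j, R j b] => [|a].
  by apply: definable_bigcap => j; case: (RP j).
by split=> H j; move: (H j); case: (RP j) => _ ->.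
Qed.

Lemma supported_sat (m n : nat) (phi : formula L n) (i : 'I_n -> nat) :
  (forall l, i l < m) -> supported m [set a : nat -> nat | sat M phi (a \o i)].
Proof.
move=> im.
exists [set b : 'I_m -> nat | sat M phi (b \o (fun l => Ordinal (im l)))] => //.
exact/definable_rename/definable_sat.
Qed.

Lemma supported_leq (m m' : nat) (A : set (nat -> nat)) :
  m <= m' -> supported m A -> supported m' A.
Proof.
move=> mm' [R dR AR]; exists [set b : 'I_m' -> nat | R (b \o widen_ord mm')].
  exact: definable_rename.
by move=> a; rewrite AR.
Qed.

(** If the guard fails, the condition is vacuous; otherwise it is an implication between formulas in
    variables with indices at most [k]. *)
Lemma supported_henkin (enum_req : nat -> requirement L) (m k : nat) :
  k < m -> supported m (henkin M enum_req k).
Proof.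
move=> km; rewrite /henkin; case: (enum_req k) => n phi i.
have [ltk|nlt] := pselect (forall l, i l < k); last first.
  suff -> : witnessed M (Requirement phi i) k = setT by exact: supported_true.
  by rewrite -subTset => a _ /nlt.
have [chi chiP] := definable_exists (definable_sat M phi).
have im l : i l < m by exact: ltn_trans km.
have kim l : extend k i l < m.
  by case: (unliftP ord0 l) => [j|] ->; rewrite ?extend0 ?extend_lift.
have := supported_imp (supported_sat chi im) (supported_sat phi kim).
congr supported; apply/seteqP; split=> a /= H.
  by move=> _ /chiP/H; rewrite comp_extend.
by rewrite comp_extend => /chiP; exact: H.
Qed.

End Supported.

(** * Realizing, omitting and isolating types *)

Section RyllNardzewski.
Variables (L : signature) (M : structure L nat).
Hypotheses (countable_L : countable_signature L) (categorical_M : aleph0_categorical M).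

(** The limit model is a countably infinite model of the theory of [M]. An isomorphism onto [M]
    turns the classes of variables into elements [v x], which exhaust [M]. *)
Lemma categorical_limit (enum_req : nat -> requirement L) (n0 : nat)
    (C : nat -> set (nat -> nat)) :
  recurring enum_req ->
  (forall k, n0 <= k -> C 0 `<=` henkin M enum_req k) ->
  (forall k, C k !=set0) -> (forall k, C k.+1 `<=` C k) ->
  exists (F : set_system (nat -> nat)) (v : nat -> nat),
    [/\ UltraFilter F, forall k, F (C k), forall y, exists x, v x = y &
      forall n (phi : formula L n) (i : 'I_n -> nat),
        sat M phi (v \o i) <-> F [set a : nat -> nat | sat M phi (a \o i)]].
Proof.
move=> rec_enum C_henkin C0 CS; have [F [UF FC]] := ultrafilter_chain C0 CS.
have F_henkin k : n0 <= k -> F (henkin M enum_req k).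
  by move=> /C_henkin sub; exact: filterS sub (FC 0).
have [_ /(_ _ _ (germ_structure M UF) M)[]] := categorical_M.
- exact: germ_countably_infinite F_henkin.
- exact: card_eqxx.
- exact: germ_models F_henkin.
- by [].
move=> h iso_h; exists F, (h \o to_germ UF); split=> //.
- move=> y; have [[h' _ h'K] _ _] := iso_h.
  by exists (of_germ (h' y)); rewrite /= of_germK h'K.
- move=> n phi i.
  by rewrite -(germ_sat UF rec_enum F_henkin) (isomorphism_sat iso_h).
Qed.

(** Formulas [psi j] outside [p] impose nothing, so [psi] can be an initial segment of an
    enumeration of all formulas. *)
Definition finitely_satisfiable (n : nat) (p : set (formula L n)) : Prop :=
  forall k (psi : 'I_k -> formula L n),
    exists b, forall j, p (psi j) -> sat M (psi j) b.

(** The set [C k] imposes the formulas of [p] among the first [k] on the variables below [n]; Henkin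
    conditions start at [n], which leaves these variables free. *)
Lemma realize_type (n : nat) (p : set (formula L n)) :
  finitely_satisfiable p -> exists b, forall phi, p phi -> sat M phi b.
Proof.
move=> fs_p.
have [enum_req rec_enum] := recurring_enum countable_L.
have [c cI] := formula_code countable_L.
have [e eK] := injective_enum (Falsum L n) (@cI n).
pose C k : set (nat -> nat) := [set a | (forall j, n <= j -> henkin M enum_req j a) /\
  forall j : 'I_k, p (e j) -> sat M (e j) (a \o (val : 'I_n -> nat))].
have [//|||k|F [v [UF FC _ vP]]] := @categorical_limit enum_req n C.
- by move=> k nk a [/(_ k nk)].
- move=> k; have [b bP] := fs_p k (e \o val).
  have [a [ab aP]] := henkin_extend M enum_req n (pad b).
  exists a; split=> // j; suff -> : a \o val = b by exact: bP.
  by rewrite -[RHS]pad_val; apply/funext => i /=; exact: ab.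
- by move=> a [aH aP]; split=> // j; exact: (aP (widen_ord (leqnSn k) j)).
exists (v \o val) => phi p_phi; apply/vP.
apply: filterS (FC (c n phi).+1) => a [_ /(_ ord_max)] /=.
by rewrite eK; exact.
Qed.

(** Stage [k] makes some formula of [p] fail at the tuple of variables [t k]. As [t] enumerates all
    [n]-tuples and the variables name every element of [M], no tuple of [M] realizes [p]. *)
Lemma omit_type (n : nat) (p : set (formula L n)) :
  (forall R : set ('I_n -> nat), definable M R -> R !=set0 ->
     exists2 b, R b & exists2 phi, p phi & ~ sat M phi b) ->
  forall b, exists2 phi, p phi & ~ sat M phi b.
Proof.
move=> non_isolated.
have [enum_req rec_enum] := recurring_enum countable_L.
have [t tK] := injective_enum (fun=> 0)
  (inj_comp (pcan_inj pickleK) (@code_tuple_inj n)).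
pose saturated := [set a | forall k, henkin M enum_req k a].
pose admissible A := A !=set0 /\ exists m B, supported M m B /\ A = saturated `&` B.
(* The projection of [A] to the coordinates [t k] is definable, since almost
   all witnessing conditions can be met afterwards: so it is not contained in
   the realizations of [p]. *)
have step (s : nat * set (nat -> nat)) : exists A', admissible s.2 ->
    [/\ admissible A', A' `<=` s.2 & exists2 psi, p psi &
       forall a, A' a -> ~ sat M psi (a \o t s.1)].
  case: s => k A /=; have [[A0 [m [B [sB AE]]]]|no] := pselect (admissible A);
    last by exists A => /no.
  suff [psi p_psi [a [Aa npsi]]] : exists2 psi, p psi &
      (A `&` [set a : nat -> nat | ~ sat M psi (a \o t k)]) !=set0.
    exists (A `&` [set a : nat -> nat | ~ sat M psi (a \o t k)]) => _; split.
    - split; first by exists a.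
      exists (maxn m (\max_l t k l).+1),
        (B `&` [set a : nat -> nat | ~ sat M psi (a \o t k)]).
      split; last by rewrite AE setIA.
      apply: supportedI; first by apply: supported_leq sB; exact: leq_maxl.
      apply: supportedC; apply: supported_sat => l.
      by rewrite (leq_trans _ (leq_maxr _ _)) // ltnS leq_bigmax.
    - by move=> b [].
    - by exists psi => // b [].
  pose m' := maxn m (\max_l t k l).+1.
  have tm' l : t k l < m' by rewrite (leq_trans _ (leq_maxr _ _)) // ltnS leq_bigmax.
  pose t' l := Ordinal (tm' l).
  have [R dR SR] : supported M m'
      (B `&` [set a | forall j : 'I_m', henkin M enum_req j a]).
    apply: supportedI; first by apply: supported_leq sB; exact: leq_maxl.
    by apply: supported_bigcap => j; exact: supported_henkin.
  have [|b [c Rc <-] [psi p_psi npsi]] := non_isolated _ (definable_image t' dR).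
    have [a] := A0; rewrite AE => -[aH Ba].
    exists ((a \o val) \o t'), (a \o val) => //.
    by apply/SR; split=> // j; exact: aH.
  (* Conditions with index below [m'] are part of [R] and hold for [c]; those from [m'] on are met
     by prolonging [c]. *)
  have [a [ac aH]] := henkin_extend M enum_req m' (pad c).
  have acE : a \o val = c by rewrite -[RHS]pad_val; apply/funext => i /=; exact: ac.
  have [Ba aH'] : (B `&` [set a | forall j : 'I_m', henkin M enum_req j a]) a.
    by apply/SR; rewrite acE.
  exists psi => //; exists a; split; last by rewrite -acE in npsi.
  rewrite AE; split=> // j; have [|jm] := leqP m' j; first exact: aH.
  exact: (aH' (Ordinal jm)).
have [g gP] := choice step.
pose C := fix C k := if k is k'.+1 then g (k', C k') else saturated.
have C_adm k : admissible (C k).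
  elim: k => [|k /(gP (k, C k))[]//]; split; last first.
    exists 0, setT; split; [exact: supported_true | by rewrite setIT].
  by have [a [_ aH]] := henkin_extend M enum_req 0 (fun=> 0); exists a => k; exact: aH.
have [//||||F [v [UF FC v_surj vP]]] := @categorical_limit enum_req 0 C.
- by move=> k _ a; exact.
- by move=> k; have [] := C_adm k.
- by move=> k; have [] := gP (k, C k) (C_adm k).
move=> b; have [w wP] := choice (fun l => v_surj (b l)).
have bE : b = v \o t (pickle (code_tuple w)).
  by rewrite -[pickle _]/((pickle \o @code_tuple n) w) tK; apply/funext => l /=.
set k := pickle _ in bE; have [_ _ [psi p_psi npsi]] := gP (k, C k) (C_adm k).
exists psi => //; rewrite bE vP => Fpsi.
by have [a [/npsi na /na]] := filter_ex (filterI (FC k.+1) Fpsi).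
Qed.

Lemma isolated_type (n : nat) (p : set (formula L n)) : finitely_satisfiable p ->
  exists R : set ('I_n -> nat), [/\ definable M R, R !=set0 &
    forall b, R b -> forall phi, p phi -> sat M phi b].
Proof.
move=> /realize_type[b bP]; apply: contrapT => none.
have [|phi /bP //] := @omit_type _ p _ b.
move=> R dR R0; apply: contrapT => all_p; apply: none.
exists R; split=> // c Rc phi p_phi.
by apply: contrapT => nphi; apply: all_p; exists c => //; exists phi.
Qed.

Definition type_equiv (n : nat) (a b : 'I_n -> nat) : Prop :=
  forall phi : formula L n, sat M phi a <-> sat M phi b.

Lemma type_equiv_sym (n : nat) (a b : 'I_n -> nat) : type_equiv a b -> type_equiv b a.
Proof. by move=> ab phi; rewrite ab. Qed.

(** The complete type of [a] is isolated by some [R]. Completeness puts [R] inside the class of [a],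
    and the formula defining [R], true at one point of the class, is true on all of it. *)
Lemma definable_type_equiv (n : nat) (a : 'I_n -> nat) : definable M (type_equiv a).
Proof.
have [|R [[chi RP] [b Rb] pR]] := @isolated_type n [set phi | sat M phi a].
  by move=> k psi; exists a.
have equivR c : R c -> type_equiv a c.
  move=> Rc phi; split; first exact: pR.
  by move=> phi_c; apply: contrapT => nphi; exact: (pR c Rc (Imp phi (Falsum L n)) nphi).
exists chi => c; rewrite -RP; split; last exact: equivR.
by move=> ac; apply/RP/ac/(equivR b Rb)/RP.
Qed.

(** Otherwise the formulas defining complements of classes of [type_equiv] are finitely satisfiable,
    so some [b] satisfies them all; but one of them excludes the class of [b]. *)
Lemma finitely_many_types (n : nat) : exists k (c : 'I_k -> 'I_n -> nat),
  forall a, exists j, type_equiv (c j) a.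
Proof.
apply: contrapT => infinite.
have [|R [_ [b Rb] pR]] := @isolated_type n
    [set phi | exists c, forall b, sat M phi b <-> ~ type_equiv c b].
  move=> k psi.
  have H j : exists c, (exists c', forall b, sat M (psi j) b <-> ~ type_equiv c' b) ->
      forall b, sat M (psi j) b <-> ~ type_equiv c b.
    have [[c cP]|no] :=
      pselect (exists c', forall b, sat M (psi j) b <-> ~ type_equiv c' b).
      by exists c.
    by exists (fun=> 0) => /no.
  have [c cP] := choice H; apply: contrapT => noa; apply: infinite; exists k, c => a.
  apply: contrapT => /forallNP nca; apply: noa; exists a => j /cP ->; exact: nca.
have [chi chiP] := definable_type_equiv b.
have /pR : [set phi | exists c, forall b, sat M phi b <-> ~ type_equiv c b]
    (Imp chi (Falsum L n)).
  by exists b => c; rewrite chiP.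
by move=> /(_ b Rb) /=; rewrite -chiP; apply => phi.
Qed.

End RyllNardzewski.

(** * Orbits as complete types *)

Section Graphs.
Variables (L : signature) (M : structure L nat).

Definition fun_graph (f : fun_sym L) : set ('I_(fun_ar f).+1 -> nat) :=
  [set c | c ord0 = fun_int M (c \o lift ord0)].
Arguments fun_graph : clear implicits.

Lemma definable_fun_graph (f : fun_sym L) : definable M (fun_graph f).
Proof.
by exists (Equal (Var L ord0) (App (fun l => Var L (lift ord0 l)))).
Qed.

Lemma definable_rel (r : rel_sym L) : definable M (rel_int M (r := r)).
Proof. by exists (Rel (fun l => Var L l)). Qed.

Lemma automorphism_of_graphs (g : Sym) :
  (forall f c, fun_graph f c -> fun_graph f (g \o c)) ->
  (forall r c, rel_int M (r := r) c <-> rel_int M (r := r) (g \o c)) ->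
  automorphism M g.
Proof.
move=> gf gr; split; [exact: sym_bij | move=> f a | exact: gr].
have := gf f (extend (fun_int M a) a); rewrite /fun_graph /mkset extend0.
have E d (b : 'I_(fun_ar f) -> nat) : extend d b \o lift ord0 = b.
  by apply/funext => i /=; rewrite extend_lift.
by rewrite comp_extend !E extend0; apply.
Qed.

Lemma automorphism_definable (g : Sym) (n : nat) (R : set ('I_n -> nat)) a :
  automorphism M g -> definable M R -> R a <-> R (g \o a).
Proof. exact: isomorphism_definable. Qed.

Lemma same_orbit_definable (n : nat) (R : set ('I_n -> nat)) a b :
  same_orbit M a b -> definable M R -> R a <-> R b.
Proof. by move=> [g ag <-]; exact: automorphism_definable. Qed.

Lemma same_orbit_refl (n : nat) (a : 'I_n -> nat) : same_orbit M a a.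
Proof. by exists 1%g => //; exact: automorphism1. Qed.

Lemma same_orbit_sym (n : nat) (a b : 'I_n -> nat) : same_orbit M a b -> same_orbit M b a.
Proof.
move=> [g ag <-]; exists (g^-1)%g; first exact: automorphismV.
by apply/funext => i /=; rewrite symVK.
Qed.

Lemma same_orbit_trans (n : nat) (b a c : 'I_n -> nat) :
  same_orbit M a b -> same_orbit M b c -> same_orbit M a c.
Proof.
by move=> [g ag <-] [h ah <-]; exists (h * g)%g; first exact: automorphismM.
Qed.

Lemma same_orbit_comp (n m : nat) (f : 'I_m -> 'I_n) (a b : 'I_n -> nat) :
  same_orbit M a b -> same_orbit M (a \o f) (b \o f).
Proof. by move=> [g ag <-]; exists g. Qed.

Definition oligomorphic : Prop := forall n, exists k (c : 'I_k -> 'I_n -> nat),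
  forall a, exists j, same_orbit M (c j) a.

Hypotheses (countable_L : countable_signature L) (categorical_M : aleph0_categorical M).

(** The class of [extend d b] is definable, so the existence of an element completing [b] to this
    class is a formula true at [b], hence at [c]. *)
Lemma type_equiv_forth (n : nat) (b c : 'I_n -> nat) : type_equiv M b c ->
  forall d, exists e, type_equiv M (extend d b) (extend e c).
Proof.
move=> bc d.
have /definable_exists[theta thetaP] :=
  definable_type_equiv countable_L categorical_M (extend d b).
have /bc/thetaP[e be] : sat M theta b by apply/thetaP; exists d.
by exists e.
Qed.

(** The bijection given by back-and-forth preserves the types of all tuples, in particular the basic
    relations and the graphs of the functions. *)
Lemma type_equiv_orbit (n : nat) (b c : 'I_n -> nat) :
  type_equiv M b c -> same_orbit M b c.
Proof.
move=> bc; have [|||| h [bij_h hbc hP]] :=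
  @back_and_forth (fun n => @type_equiv L M n) _ _ _ _ n b c bc.
- by move=> {b c bc} {}n m f b c bc phi; have := bc (rename phi f); rewrite !sat_rename.
- by move=> {b c bc} b c bc; exact: (bc (Equal (Var L ord0) (Var L ord_max))).
- exact: type_equiv_forth.
- move=> {b c bc} {}n b c /type_equiv_sym/type_equiv_forth cb e.
  by have [d /type_equiv_sym] := cb e; exists d.
exists (mk_sym bij_h) => //; apply: automorphism_of_graphs => [f|r] a.
  have [phi phiP] := definable_fun_graph f.
  by move=> /phiP/hP/phiP.
have [phi phiP] := definable_rel r.
by rewrite !phiP; exact: hP.
Qed.

Lemma categorical_oligomorphic : oligomorphic.
Proof.
move=> n; have [k [c cP]] := finitely_many_types countable_L categorical_M n.
by exists k, c => a; have [j /type_equiv_orbit] := cP a; exists j.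
Qed.

End Graphs.

Lemma interdefinable_automorphism (L L' : signature) (M : structure L nat)
    (N : structure L' nat) (g : Sym) :
  interdefinable M N -> automorphism N g -> automorphism M g.
Proof.
move=> MN ag; apply: automorphism_of_graphs => [f|r] a.
  have /MN dN := definable_fun_graph M f.
  by move/(automorphism_definable a ag dN).
have /MN dN := definable_rel M r; exact: (automorphism_definable a ag dN).
Qed.

(** * The topology of the orbital quotient *)

Lemma nbhs_cylinder (n : nat) (f : {ptws nat -> nat}) :
  nbhs f [set g : {ptws nat -> nat} | forall i : 'I_n, g i = f i].
Proof.
have := @filter_forall _ 'I_n
  (fun i => [set g : {ptws nat -> nat} | g i = f i]) (nbhs f) _.
apply => i.
have := @proj_continuous nat (fun=> nat) i f [set f i].
by apply; exact: discrete_set1.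
Qed.

(** The filter generated by the cylinders around [f] converges to [f] pointwise, so it contains
    every neighbourhood of [f]. *)
Lemma nbhs_ptws_nat (f : {ptws nat -> nat}) (A : set {ptws nat -> nat}) :
  nbhs f A -> exists n, forall g : nat -> nat, (forall i : 'I_n, g i = f i) -> A g.
Proof.
pose G := filter_from [set: nat]
  (fun n => [set g : nat -> nat | forall i : 'I_n, g i = f i]).
have FG : Filter G.
  apply: filter_from_filter; first by exists 0.
  move=> i j _ _; exists (maxn i j) => // g gf; split=> k.
    exact: (gf (widen_ord (leq_maxl i j) k)).
  exact: (gf (widen_ord (leq_maxr i j) k)).
have /[apply] : {ptws, G --> f}.
  apply/pointwise_cvgP => t B /nbhs_singleton Bft.
  by exists t.+1 => // g gf; rewrite /= (gf ord_max).
by move=> [n _ nA]; exists n.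
Qed.

Section OrbitalQuotient.
Variables (L : signature) (M : structure L nat).

Local Notation V := (orbital_quotient M).
Local Notation H := (Aut_orbital M).
Local Notation coset := (@to_coset H (Aut_normal M)).

Definition act (h : H) : nat -> nat := sym_fun (\val h).

Lemma act_inj (h : H) : injective (act h).
Proof. exact: bij_inj (sym_bij _). Qed.

Lemma act_orbit (h : H) (n : nat) (a b : 'I_n -> nat) :
  same_orbit M a b <-> same_orbit M (act h \o a) (act h \o b).
Proof.
case: n a b => [|n] a b; last exact: orbital_same_orbit (set_valP h).
(* The orbital language has no relation for arity 0, where all tuples coincide. *)
have -> : a = b by apply/funext => -[].
by split=> _; exact: same_orbit_refl.
Qed.

Lemma act_coset (h k : H) (n : nat) (a : 'I_n -> nat) :
  coset h = coset k -> same_orbit M (act h \o a) (act k \o a).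
Proof.
move=> /coset_eqP/asboolP hk.
have -> : act k \o a = act h \o (act (h^-1 * k)%g \o a).
  by rewrite -[k in LHS](mulVKg h).
by apply: (act_orbit h _ _).1; exists (\val (h^-1 * k)%g).
Qed.

(** Every finite tuple is a reindexing of an initial segment, so [h^-1 * k] preserves all orbits of
    [Aut M] and therefore lies in [Aut M]. *)
Lemma coset_eq_of_orbits (h k : H) :
  (forall n, same_orbit M (act h \o (val : 'I_n -> nat)) (act k \o val)) ->
  coset h = coset k.
Proof.
move=> hk; apply/coset_eqP/asboolP; apply: automorphism_same_orbit => n a.
apply: (act_orbit h _ _).2.
have -> : act h \o (act (h^-1 * k)%g \o a) = act k \o a.
  by rewrite -[k in RHS](mulVKg h).
pose m := (\max_i a i).+1.
have am i : a i < m by rewrite ltnS; exact: leq_bigmax.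
exact: (same_orbit_comp (fun i => Ordinal (am i)) (hk m)).
Qed.

(** A chosen representative acts; the image of a tuple is meaningful only up to [same_orbit]. *)
Definition vact (u : V) : nat -> nat := act (repr (u : quotient_group (Aut_normal M))).

Lemma vact_coset (h : H) (n : nat) (a : 'I_n -> nat) :
  same_orbit M (vact (coset h) \o a) (act h \o a).
Proof. by apply: act_coset; rewrite coset_repr. Qed.

Lemma vact_orbit (u : V) (n : nat) (a b : 'I_n -> nat) :
  same_orbit M a b <-> same_orbit M (vact u \o a) (vact u \o b).
Proof. exact: act_orbit. Qed.

Lemma vactM (u v : V) (n : nat) (a : 'I_n -> nat) :
  same_orbit M (vact (u * v)%g \o a) (vact u \o (vact v \o a)).
Proof. exact: (vact_coset (repr _ * repr _)%g). Qed.

Lemma vact1 (n : nat) (a : 'I_n -> nat) : same_orbit M (vact 1%g \o a) a.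
Proof. exact: (vact_coset 1%g). Qed.

Definition agree (n : nat) (u v : V) : Prop :=
  same_orbit M (vact u \o (val : 'I_n -> nat)) (vact v \o val).

Lemma agree_sym (n : nat) (u v : V) : agree n u v -> agree n v u.
Proof. exact: same_orbit_sym. Qed.

Lemma agree_trans (n : nat) (v u w : V) : agree n u v -> agree n v w -> agree n u w.
Proof. exact: same_orbit_trans. Qed.

Lemma agree_orbit (n m : nat) (a : 'I_m -> nat) (u v : V) :
  (forall i, a i < n) -> agree n u v -> same_orbit M (vact u \o a) (vact v \o a).
Proof. by move=> an uv; exact: (same_orbit_comp (fun i => Ordinal (an i)) uv). Qed.

Lemma agree_eq (u v : V) : (forall n, agree n u v) -> u = v.
Proof.
by move=> uv; rewrite -[u]coset_repr -[v]coset_repr; exact: coset_eq_of_orbits.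
Qed.

Lemma open_agree (n : nat) (u : V) : open [set v | agree n u v].
Proof.
pose C := [set f : {ptws nat -> nat} |
  same_orbit M (vact u \o (val : 'I_n -> nat)) (f \o val)].
have oC : open C.
  rewrite openE => f Cf; apply: filterS (nbhs_cylinder n f) => g gf.
  rewrite /C /mkset; suff -> : g \o val = f \o (val : 'I_n -> nat) by [].
  exact/funext.
(* Openness in the quotient is openness of the preimage in [H], a subspace of [Sym], which is a
   subspace of [{ptws nat -> nat}]: hence two nested witnesses. *)
exists (sym_fun @^-1` C); first by exists C.
apply/seteqP; split=> h /= uh.
  exact: same_orbit_trans uh (same_orbit_sym (vact_coset h _)).
exact: same_orbit_trans uh (vact_coset h _).
Qed.

Lemma nbhs_agree (u : V) (A : set V) :
  nbhs u A <-> exists n, [set v | agree n u v] `<=` A.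
Proof.
split=> [|[n nA]]; last first.
  apply: filterS nA _; apply: open_nbhs_nbhs; split; first exact: open_agree.
  exact: same_orbit_refl.
move=> [B [[B' [C oC B'C] BB'] Bu] BA].
have Cu : C (vact u).
  have : (sym_fun @^-1` C) (\val (repr (u : quotient_group (Aut_normal M)))).
    rewrite [_ @^-1` _]B'C -[B' _]/((\val @^-1` B') _) BB' /= .
    by rewrite -[X in B X](coset_repr u) in Bu.
  by [].
have [n nC] := nbhs_ptws_nat (open_nbhs_nbhs (conj oC Cu)).
exists n => v [g ag gE]; apply: BA.
(* Multiplying the representative of [v] by [g^-1] gives a representative of [v] that equals that of
   [u] on [0, ..., n-1]. *)
pose k : H := exist _ (g^-1)%g (mem_set (automorphism_orbital (automorphismV ag))).
pose h := (k * repr (v : quotient_group (Aut_normal M)))%g.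
have hv : coset h = v.
  rewrite -[RHS]coset_repr; apply: coset_eq_of_orbits => m.
  by exists g => //; apply/funext => i; exact: symKVg.
rewrite -hv; suff : (\val @^-1` B') h by rewrite BB'.
rewrite -B'C; apply: nC => i.
have /= E := congr1 (@^~ i) gE.
by rewrite -[LHS]/(((g^-1)%g : Sym) (vact v i)) -E; exact: symVK.
Qed.

Lemma topological_group_quotient : topological_group V.
Proof.
split.
- move=> [u v] A /nbhs_agree[n nA].
  (* The product on [0, ..., n-1] involves [u] only at the images under [v], which lie below [l]. *)
  pose l := (\max_(i < n) vact v i).+1.
  have vl (i : 'I_n) : vact v (val i) < l by rewrite ltnS; exact: leq_bigmax.
  exists ([set u' | agree l u u'], [set v' | agree n v v']).
    by split; apply/nbhs_agree; [exists l | exists n].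
  move=> [u' v'] /= [uu' vv']; apply: nA.
  apply: same_orbit_trans (vactM u v _) _.
  apply: same_orbit_trans _ (same_orbit_sym (vactM u' v' _)).
  apply: same_orbit_trans (agree_orbit vl uu') _.
  by apply: (vact_orbit u' _ _).1; exact: vv'.
- move=> u A /nbhs_agree[n nA].
  pose l := (\max_(i < n) vact (u^-1)%g i).+1.
  have ul (i : 'I_n) : vact (u^-1)%g (val i) < l by rewrite ltnS; exact: leq_bigmax.
  suff : [set u' | agree l u u'] `<=` (fun x => x^-1)%g @^-1` A.
    by move=> sub; apply/nbhs_agree; exists l.
  (* After applying [u'], it remains to compare [u' (u^-1 i)] with [u' (u'^-1 i)]; the first is in
     the orbit of [u (u^-1 i)] by the choice of [l]. *)
  move=> u' uu'; apply: nA; apply: (vact_orbit u' _ _).2.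
  apply: same_orbit_trans (same_orbit_sym (agree_orbit ul uu')) _.
  apply: same_orbit_trans (same_orbit_sym (vactM u u^-1%g _)) _.
  apply: same_orbit_trans _ (vactM u' u'^-1%g _).
  by rewrite !mulgV; exact: same_orbit_refl.
Qed.

Lemma hausdorff_quotient : hausdorff_space V.
Proof.
move=> u v uv; apply: agree_eq => n.
have [||w [uw vw]] := uv [set w | agree n u w] [set w | agree n v w].
- by apply/nbhs_agree; exists n.
- by apply/nbhs_agree; exists n.
exact: agree_trans uw (agree_sym vw).
Qed.

Lemma clopen_agree (n : nat) (u : V) : clopen [set v | agree n u v].
Proof.
split; first exact: open_agree.
rewrite -[X in closed X]setCK; apply: open_closedC.
rewrite openE => v /= nuv; apply/nbhs_agree; exists n => w vw uw.
by apply: nuv; exact: agree_trans uw (agree_sym vw).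
Qed.

Lemma totally_disconnected_quotient : totally_disconnected [set: V].
Proof.
apply: zero_dimension_totally_disconnected => u v /eqP uv.
have [n nuv] : exists n, ~ agree n u v.
  by apply/existsNP => /agree_eq.
exists [set w | agree n u w]; split=> //; first exact: clopen_agree.
exact: same_orbit_refl.
Qed.

Hypothesis oligo : oligomorphic M.

Lemma compact_quotient : compact [set: V].
Proof.
rewrite compact_ultra => F UF _.
pose P n (b c : 'I_n -> nat) := F [set u | same_orbit M (vact u \o b) c].
have P_total n (b : 'I_n -> nat) : exists c, P n b c.
  have [k [c cP]] := oligo n.
  have [|j Fj] := ultrafilter_finite_cover UF
    (A := fun j => [set u | same_orbit M (vact u \o b) (c j)]).
    by move=> u; have [j /same_orbit_sym] := cP (vact u \o b); exists j.
  by exists (c j).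
have P_surj n (c : 'I_n -> nat) : exists b, P n b c.
  have [k [b bP]] := oligo n.
  have [|j Fj] := ultrafilter_finite_cover UF
    (A := fun j => [set u | same_orbit M (vact u \o b j) c]).
    (* A preimage of [c] under [u] can be sought among the finitely many orbit representatives
       [b j]. *)
    move=> u; have [j bj] := bP (vact (u^-1)%g \o c); exists j.
    apply: same_orbit_trans ((vact_orbit u _ _).1 bj) _.
    apply: same_orbit_trans (same_orbit_sym (vactM u u^-1%g _)) _.
    by rewrite mulgV; exact: vact1.
  by exists (b j).
have P_move n (b b' c c' : 'I_n -> nat) :
    same_orbit M b b' -> same_orbit M c c' -> P n b c -> P n b' c'.
  move=> bb' cc'; apply: filterS => u ubc.
  apply: same_orbit_trans _ (same_orbit_trans ubc cc').
  exact/same_orbit_sym/(vact_orbit u _ _).1.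
have P_orbit n (b b' c c' : 'I_n -> nat) :
    P n b c -> P n b' c' -> same_orbit M b b' <-> same_orbit M c c'.
  move=> Fbc Fbc'; have [u [ub ub']] := filter_ex (filterI Fbc Fbc').
  split=> [/(vact_orbit u) bb'|cc'].
    exact: same_orbit_trans (same_orbit_sym ub) (same_orbit_trans bb' ub').
  apply/(vact_orbit u).
  exact: same_orbit_trans ub (same_orbit_trans cc' (same_orbit_sym ub')).
have P_comp n m (f : 'I_m -> 'I_n) b c : P n b c -> P m (b \o f) (c \o f).
  by apply: filterS => u; exact: same_orbit_comp.
have compl n d (b : 'I_n -> nat) : extend d b \o lift ord0 = b.
  by apply/funext => i /=; rewrite extend_lift.
have P_forth n b c : P n b c -> forall d, exists e, P n.+1 (extend d b) (extend e c).
  move=> Pbc d; have [c1 Pc1] := P_total _ (extend d b).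
  have := P_comp _ _ (lift ord0) _ _ Pc1; rewrite compl => Pbc1.
  (* The tail of [c1] is only in the orbit of [c]; an automorphism moves it onto [c] and carries the
     new entry along. *)
  have [g ag gE] := (P_orbit _ _ _ _ _ Pbc1 Pbc).1 (same_orbit_refl _ _).
  exists (g (c1 ord0)); apply: P_move Pc1; first exact: same_orbit_refl.
  by exists g => //; rewrite -{1}(extend_eta c1) comp_extend gE.
have P_back n b c : P n b c -> forall e, exists d, P n.+1 (extend d b) (extend e c).
  move=> Pbc e; have [b1 Pb1] := P_surj _ (extend e c).
  have := P_comp _ _ (lift ord0) _ _ Pb1; rewrite compl => Pbc1.
  have [g ag gE] := (P_orbit _ _ _ _ _ Pbc1 Pbc).2 (same_orbit_refl _ _).
  exists (g (b1 ord0)); apply: P_move Pb1; last exact: same_orbit_refl.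
  by exists g => //; rewrite -{1}(extend_eta b1) comp_extend gE.
have P_inj (b c : 'I_2 -> nat) : P 2 b c -> b ord0 = b ord_max <-> c ord0 = c ord_max.
  move=> /filter_ex[u [g _ gE]]; rewrite -gE /=; split=> [->//|].
  by move=> /(bij_inj (sym_bij g))/act_inj.
have P0 : P 0 (fun=> 0) (fun=> 0).
  by have [c] := P_total 0 (fun=> 0); congr P; apply/funext => -[].
have [h [bij_h _ hP]] := back_and_forth P_comp P_inj P_forth P_back P0.
have aut_h : automorphism (orbital_structure M) (mk_sym bij_h).
  by split=> [||[n n_gt0] c]; [exact: bij_h | case | exact: P_orbit].
pose hh : H := exist _ (mk_sym bij_h) (mem_set aut_h).
exists (coset hh); split=> // A /nbhs_agree[n nA].
apply: filterS (hP n val) => u uh; apply: nA.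
exact: same_orbit_trans (vact_coset hh _) (same_orbit_sym uh).
Qed.

Lemma profinite_quotient : profinite V.
Proof.
split; [exact: topological_group_quotient | exact: compact_quotient |
  exact: hausdorff_quotient | exact: totally_disconnected_quotient].
Qed.

End OrbitalQuotient.

(** * Finiteness of the quotient *)

Lemma bounded_representatives (L : signature) (M : structure L nat) (m : nat) :
  oligomorphic M -> exists l, forall n (a : 'I_n -> nat), n <= m ->
    exists2 b : 'I_n -> nat, same_orbit M b a & forall i, b i < l.
Proof.
move=> oligo.
have rep n : exists l, forall a : 'I_n -> nat,
    exists2 b : 'I_n -> nat, same_orbit M b a & forall i, b i < l.
  have [k [c cP]] := oligo n; exists (\max_j \max_i c j i).+1 => a.
  have [j ja] := cP a; exists (c j) => // i; rewrite ltnS.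
  by apply: leq_trans (leq_bigmax j); exact: (@leq_bigmax _ (c j)).
have [l lP] := choice rep; exists (\max_(n < m.+1) l n) => n a nm.
have [b ba bl] := lP n a; exists b => // i; apply: leq_trans (bl i) _.
exact: (@leq_bigmax _ (fun n : 'I_m.+1 => l n) (Ordinal (nm : n < m.+1))).
Qed.

(** With [l] bounding representatives of all orbits of arity at most [m], a coset is determined by
    the orbit of the image of [0, ..., l-1], and there are finitely many orbits of [l]-tuples. *)
Lemma finite_quotient (L : signature) (M : structure L nat) (m : nat) :
  oligomorphic M ->
  (forall h : Aut_orbital M,
     (forall n (a : 'I_n -> nat), n <= m -> same_orbit M a (act h \o a)) ->
     automorphism M (\val h)) ->
  finite_set [set: orbital_quotient M].
Proof.
move=> oligo fixed_aut; have [l lP] := bounded_representatives m oligo.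
have agree_l (u v : orbital_quotient M) : agree l u v -> u = v.
  move=> uv; rewrite -[u]coset_repr -[v]coset_repr; apply/coset_eqP/asboolP.
  set ru := repr _; set rv := repr _; apply: fixed_aut => n a /lP-/(_ a)[b ba bl].
  apply: same_orbit_trans (same_orbit_sym ba) _.
  apply: same_orbit_trans _ ((act_orbit _ _ _).1 ba).
  apply: (act_orbit ru _ _).2.
  have -> : act ru \o (act (ru^-1 * rv)%g \o b) = act rv \o b.
    by rewrite -[rv in RHS](mulVKg ru).
  exact: agree_orbit bl uv.
have [k [c cP]] := oligo l.
have [f fP] := choice (fun u : orbital_quotient M => cP (vact u \o val)).
have f_inj : injective f.
  move=> u v fuv; apply: agree_l; apply: same_orbit_trans (same_orbit_sym (fP u)) _.
  by rewrite fuv.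
have inv j : exists u, forall v, f v = j -> u = v.
  have [[u fu]|no] := pselect (exists u, f u = j).
    by exists u => v fv; apply: f_inj; rewrite fu.
  by exists 1%g => v fv; case: no; exists v.
have [e eP] := choice inv.
apply: (@sub_finite_set _ _ (e @` setT)) => [u _|].
  by exists (f u) => //; exact: eP.
exact/finite_image/finite_finset.
Qed.

Lemma finite_set_bound (T : Type) (ar : T -> nat) :
  finite_set [set: T] -> exists m, forall x, ar x <= m.
Proof.
move=> /(finite_image ar)/finite_seqP[s sE]; exists (\max_(x <- s) x) => x.
have : (ar @` setT) (ar x) by exists x.
by rewrite sE => xs; exact: (@leq_bigmax_seq _ s xpredT id (ar x) xs isT).
Qed.

Theorem theorem3p4 (L : signature) (M : structure L nat)
    (countable_L : countable_signature L) (categorical_M : aleph0_categorical M) :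
  profinite (orbital_quotient M) /\
  ((exists (L' : signature) (N : structure L' nat),
      finite_signature L' /\ interdefinable M N) ->
   finite_set [set: orbital_quotient M]).
Proof.
have oligo := categorical_oligomorphic countable_L categorical_M.
split=> [|[L' [N [[fin_f fin_r] MN]]]]; first exact: profinite_quotient.
have [mf mfP] := finite_set_bound (@fun_ar L') fin_f.
have [mr mrP] := finite_set_bound (@rel_ar L') fin_r.
(* The successor accounts for the value coordinate in the graph of a function. Basic relations and
   graphs of [N] are definable in [M], so fixing the orbits of these arities makes [h] an
   automorphism of [N], hence of [M]. *)
apply: (@finite_quotient _ _ (maxn mf.+1 mr)) => // h h_fixed.
apply: (interdefinable_automorphism MN); apply: automorphism_of_graphs => [f|r] c.
  have /MN dM := definable_fun_graph N f.
  apply: (same_orbit_definable _ dM).1; apply: h_fixed.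
  by rewrite leq_max ltnS mfP.
have /MN dM := definable_rel N r.
apply: same_orbit_definable dM; apply: h_fixed.
by rewrite leq_max mrP orbT.
Qed.
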